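(* Let $M$ be a non-singular square matrix over a field, with rows and columns indexed by a finite set $V$. Then (1) $P_{\langle\tau\delta\tau\rangle}(M,z)=P_{\langle\tau\rangle}(M^{-1},z)$, and (2) $P_{\langle\delta\tau\rangle}(M,z)=P_{\langle\tau\delta\rangle}(M^{-1},z)$.
   Context: For $A\subseteq V$: $M[A]$ is the principal submatrix on $A$, $A^c=V\setminus A$, $I_A$ is the diagonal matrix with $(I_A)_{ii}=1$ for $i\in A$ and $0$ otherwise, and $\operatorname{corank}$ of a square matrix is its size minus its rank (empty matrices have rank $0$). Define $r_{\langle\tau\rangle}(M,A)=\operatorname{rank}(M+I_A)$, $r_{\langle\delta\tau\rangle}(M,A)=\operatorname{rank}((M+I_A)[A])+\operatorname{rank}(M[A^c])$, $r_{\langle\tau\delta\rangle}(M,A)=\operatorname{rank}(M+I_A)-\operatorname{corank}(M[A])$, $r_{\langle\tau\delta\tau\rangle}(M,A)=\operatorname{rank}(M)-\operatorname{corank}((M+I_A)[A])$, and $P_{\langle\bullet\rangle}(M,z)=\sum_{A\subseteq V} z^{r_{\langle\bullet\rangle}(M,A)}$. Here $M^{-1}$ is indexed by $V$ as well. *)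

(* Defs.v *)
From mathcomp Require Import all_boot all_order all_algebra.

Set Implicit Arguments.
Unset Strict Implicit.
Unset Printing Implicit Defensive.

Import GRing.Theory.
Local Open Scope ring_scope.

Definition princ_submx (F : fieldType) (n : nat) (A : {set 'I_n})
    (M : 'M[F]_n) : 'M[F]_#|A| :=
  mxsub enum_val enum_val M.

Definition indic_mx (F : fieldType) (n : nat) (A : {set 'I_n}) : 'M[F]_n :=
  \matrix_(i, j) ((i == j) && (i \in A))%:R.

Definition corank (F : fieldType) (n : nat) (M : 'M[F]_n) : nat :=
  (n - \rank M)%N.

(* Name suffixes: t is tau, d is delta.
   The natural-number subtractions in [r_td] and [r_tdt] are never truncated:
   see [r_td_untruncated] and [r_tdt_untruncated] below. *)

(* The argument of [\rank] is parsed in the scope of row spaces, where [+] is the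
   sum of subspaces; [%R] makes it the sum of matrices. *)
Definition r_t (F : fieldType) (n : nat) (M : 'M[F]_n) (A : {set 'I_n}) : nat :=
  \rank (M + indic_mx F A)%R.

Definition r_dt (F : fieldType) (n : nat) (M : 'M[F]_n) (A : {set 'I_n}) : nat :=
  (\rank (princ_submx A (M + indic_mx F A)%R) + \rank (princ_submx (~: A) M))%N.

Definition r_td (F : fieldType) (n : nat) (M : 'M[F]_n) (A : {set 'I_n}) : nat :=
  (\rank (M + indic_mx F A)%R - corank (princ_submx A M))%N.

Definition r_tdt (F : fieldType) (n : nat) (M : 'M[F]_n) (A : {set 'I_n}) : nat :=
  (\rank M - corank (princ_submx A (M + indic_mx F A)%R))%N.

Definition subset_poly (n : nat) (r : {set 'I_n} -> nat) : {poly int} :=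
  \sum_(A : {set 'I_n}) 'X^(r A).

Definition P_t (F : fieldType) (n : nat) (M : 'M[F]_n) : {poly int} :=
  subset_poly (r_t M).

Definition P_dt (F : fieldType) (n : nat) (M : 'M[F]_n) : {poly int} :=
  subset_poly (r_dt M).

Definition P_td (F : fieldType) (n : nat) (M : 'M[F]_n) : {poly int} :=
  subset_poly (r_td M).

Definition P_tdt (F : fieldType) (n : nat) (M : 'M[F]_n) : {poly int} :=
  subset_poly (r_tdt M).

Lemma princ_submx_indic (F : fieldType) (n : nat) (A : {set 'I_n})
    (M : 'M[F]_n) :
  princ_submx A (M + indic_mx F A)%R = princ_submx A M + 1%:M.
Proof.
apply/matrixP=> i j; rewrite !mxE enum_valP andbT.
by rewrite (inj_eq enum_val_inj).
Qed.

Lemma leq_corank_princ (F : fieldType) (n : nat) (A : {set 'I_n})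
    (X : 'M[F]_n) (S : 'M[F]_#|A|) (c : F) :
  c != 0 -> princ_submx A X = S + c%:M -> (corank S <= \rank X)%N.
Proof.
move=> c0 XS; rewrite /corank -mxrank_ker -(mxrank_scale_nz (kermx S) c0).
have -> : c *: kermx S = kermx S *m princ_submx A X.
  by rewrite XS mulmxDr mulmx_ker add0r mul_mx_scalar.
apply: leq_trans (mxrankM_maxr _ _) _.
rewrite /princ_submx mxsubrc.
apply: leq_trans (mxrankS (rowsub_sub _ _)) _.
rewrite -mxrank_tr trmx_mxsub -[leqRHS]mxrank_tr.
exact: mxrankS (rowsub_sub _ _).
Qed.

Lemma r_td_untruncated (F : fieldType) (n : nat) (M : 'M[F]_n)
    (A : {set 'I_n}) :
  (corank (princ_submx A M) <= \rank (M + indic_mx F A)%R)%N.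
Proof.
exact: leq_corank_princ (oner_neq0 F) (princ_submx_indic A M).
Qed.

Lemma r_tdt_untruncated (F : fieldType) (n : nat) (M : 'M[F]_n)
    (A : {set 'I_n}) :
  (corank (princ_submx A (M + indic_mx F A)%R) <= \rank M)%N.
Proof.
apply: (@leq_corank_princ F n A M _ (- 1)); first by rewrite oppr_eq0 oner_eq0.
by rewrite princ_submx_indic raddfN addrK.
Qed.

(* Main.v *)
(* Both identities hold term by term.  The corank of 1 + P Q equals that of
   1 + Q P, and M (M^-1 + I_A) = 1 + M I_A, so M^-1 + I_A and (M + I_A)[A] have
   the same corank; this gives (1).  For (2), combine it with the nullity
   theorem: M^-1[A] and M[A^c] have the same corank. *)
Require Import Defs.
From mathcomp Require Import all_boot all_order all_algebra.

Local Open Scope ring_scope.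

Import GRing.Theory.

(** Right multiplication by [L] maps the left kernel of [A] injectively into that of [B]. The
    hypotheses take square [x], so that a whole kernel matrix can be substituted at once. *)
Lemma leq_corank (F : fieldType) (m p : nat) (A : 'M[F]_m) (B : 'M[F]_p)
    (L : 'M[F]_(m, p)) :
  (forall x : 'M_m, x *m A = 0 -> x *m L *m B = 0) ->
  (forall x : 'M_m, x *m A = 0 -> x *m L = 0 -> x = 0) ->
  (corank A <= corank B)%N.
Proof.
move=> LAB Linj; rewrite /corank -!mxrank_ker.
have kerAL0 : (kermx A :&: kermx L)%MS = 0.
  by apply: Linj; apply/sub_kermxP; rewrite ?capmxSl ?capmxSr.
rewrite -(mxrank_mul_ker (kermx A) L) kerAL0 mxrank0 addn0.
by apply/mxrankS/sub_kermxP/LAB; rewrite mulmx_ker.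
Qed.

(** The kernel map is [x] to [x *m P]. It is injective there because [x = - x *m P *m Q] on the left
    kernel of [1 + P Q]. *)
Lemma leq_corank_add1_mulmxC (F : fieldType) (m p : nat) (P : 'M[F]_(m, p))
    (Q : 'M[F]_(p, m)) :
  (corank (1%:M + P *m Q)%R <= corank (1%:M + Q *m P)%R)%N.
Proof.
apply: (@leq_corank _ _ _ _ _ P) => x.
  move=> x0; have -> : x *m P *m (1%:M + Q *m P) = x *m (1%:M + P *m Q) *m P.
    by rewrite !mulmxDr !mulmx1 mulmxDl !mulmxA.
  by rewrite x0 mul0mx.
by rewrite mulmxDr mulmx1 mulmxA => x0 xP; move: x0; rewrite xP mul0mx addr0.
Qed.

Lemma corank_add1_mulmxC (F : fieldType) (m p : nat) (P : 'M[F]_(m, p))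
    (Q : 'M[F]_(p, m)) :
  corank (1%:M + P *m Q)%R = corank (1%:M + Q *m P)%R.
Proof. by apply/eqP; rewrite eqn_leq !leq_corank_add1_mulmxC. Qed.

(** Right multiplication by this matrix extends a row vector on [A] by zero; its transpose restricts
    a row vector to [A]. Principal submatrices thus become matrix products. *)
Definition restr_mx (F : fieldType) (n : nat) (A : {set 'I_n}) :
  'M[F]_(#|A|, n) := rowsub enum_val 1%:M.

Lemma princ_submxE (F : fieldType) (n : nat) (A : {set 'I_n}) (M : 'M[F]_n) :
  princ_submx A M = restr_mx F n A *m M *m (restr_mx F n A)^T.
Proof.
rewrite /restr_mx trmx_mxsub trmx1 mul_rowsub_mx mul1mx.
by rewrite mulmx_colsub mulmx1 -mxsubcr.
Qed.

Lemma restr_mx_trK (F : fieldType) (n : nat) (A : {set 'I_n}) :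
  restr_mx F n A *m (restr_mx F n A)^T = 1%:M.
Proof.
rewrite -[restr_mx _ _ _ in X in X *m _]mulmx1 -princ_submxE.
by apply/matrixP=> i j; rewrite !mxE (inj_eq enum_val_inj).
Qed.

Lemma tr_restr_mxK (F : fieldType) (n : nat) (A : {set 'I_n}) :
  (restr_mx F n A)^T *m restr_mx F n A = indic_mx F A.
Proof.
apply/matrixP=> i j; rewrite !mxE.
under eq_bigr do rewrite !mxE.
(* The sum over positions in the enumeration of [A] becomes a sum over the elements [k] of [A],
   where only [k = i] can contribute. *)
rewrite -(big_enum_val (fun k => (k == i)%:R * (k == j)%:R)) /=.
case: (boolP (i \in A)) => iA.
  rewrite (bigD1 i) //= eqxx mul1r big1 ?addr0 ?andbT // => k /andP[_ /negPf->].
  by rewrite mul0r.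
rewrite andbF big1 // => k kA; case: eqP => [ki|]; last by rewrite mul0r.
by rewrite -ki kA in iA.
Qed.

Lemma indic_mxC (F : fieldType) (n : nat) (A : {set 'I_n}) :
  indic_mx F A + indic_mx F (~: A) = 1%:M.
Proof.
apply/matrixP=> i j; rewrite !mxE inE.
by case: (i == j); case: (i \in A); rewrite /= ?addr0 ?add0r.
Qed.

Lemma restr_mx_setC (F : fieldType) (n : nat) (A : {set 'I_n}) :
  restr_mx F n A *m (restr_mx F n (~: A))^T = 0.
Proof.
apply/matrixP=> i j; rewrite /restr_mx trmx_mxsub trmx1 mulmx_colsub.
rewrite mulmx1 !mxE.
case: eqP => // ij; have := enum_valP j.
by rewrite -ij inE enum_valP.
Qed.

Lemma corank_unitmx_mul (F : fieldType) (n : nat) (M X : 'M[F]_n) :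
  M \in unitmx -> corank (M *m X) = corank X.
Proof.
move=> hM; rewrite /corank; congr (_ - _)%N.
by rewrite eqmxMfull ?row_full_unit.
Qed.

Lemma corank_invmx_add_indic (F : fieldType) (n : nat) (M : 'M[F]_n)
    (A : {set 'I_n}) : M \in unitmx ->
  corank (invmx M + indic_mx F A) = corank (princ_submx A (M + indic_mx F A)).
Proof.
move=> hM; rewrite -(corank_unitmx_mul _ _ M) // mulmxDr mulmxV //.
(* Writing [R] for [restr_mx F n A], [I_A = R^T R]. Exchanging the factors [M R^T] and [R] reduces
   the size from [n] to [#|A|] and produces [R M R^T = M[A]]. *)
rewrite -tr_restr_mxK mulmxA corank_add1_mulmxC tr_restr_mxK.
by rewrite princ_submx_indic addrC princ_submxE mulmxA.
Qed.

(** If [x N[A] = 0], then [y = x R N] vanishes on [A], so its restriction to the complement carries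
    all of [y]. Since [y M = x R] vanishes off [A], that restriction is killed by [M[A^c]]. If it is
    zero, then [y = 0], hence [x R = y M = 0] and [x = 0]. *)
Lemma leq_corank_princ_setC (F : fieldType) (n : nat) (M N : 'M[F]_n)
    (A : {set 'I_n}) : N *m M = 1%:M ->
  (corank (princ_submx A N) <= corank (princ_submx (~: A) M))%N.
Proof.
move=> NM; rewrite !princ_submxE.
set R := restr_mx F n A; set S := restr_mx F n (~: A).
have RS1 : R^T *m R + S^T *m S = 1%:M by rewrite !tr_restr_mxK indic_mxC.
apply: (@leq_corank _ _ _ _ _ (R *m N *m S^T)) => x.
  rewrite !mulmxA => x0.
  have -> : x *m R *m N *m S^T *m S = x *m R *m N.
    rewrite -[RHS]mulmx1 -RS1 mulmxDr !mulmxA.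
    by rewrite x0 mul0mx add0r.
  by rewrite -(mulmxA _ N M) NM mulmx1 -mulmxA restr_mx_setC mulmx0.
rewrite !mulmxA => xR xS.
have xRN : x *m R *m N = 0.
  by rewrite -[LHS]mulmx1 -RS1 mulmxDr !mulmxA xR xS !mul0mx addr0.
by rewrite -[x]mulmx1 -(restr_mx_trK F n A) mulmxA -[x *m _]mulmx1 -NM
  mulmxA xRN !mul0mx.
Qed.

Lemma corank_princ_invmx (F : fieldType) (n : nat) (M : 'M[F]_n)
    (A : {set 'I_n}) : M \in unitmx ->
  corank (princ_submx A (invmx M)) = corank (princ_submx (~: A) M).
Proof.
move=> hM; apply/eqP; rewrite eqn_leq leq_corank_princ_setC ?mulVmx //=.
(* The reverse inequality is the same lemma with [M] and its inverse exchanged and [A] replaced by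
   its complement. *)
by have := @leq_corank_princ_setC F n _ _ (~: A) (mulmxV hM); rewrite setCK.
Qed.

Lemma rank_corank (F : fieldType) (n : nat) (M : 'M[F]_n) :
  (\rank M + corank M = n)%N.
Proof. by rewrite /corank subnKC ?rank_leq_row. Qed.

Lemma r_tdt_invmx (F : fieldType) (n : nat) (M : 'M[F]_n) (A : {set 'I_n}) :
  M \in unitmx -> r_tdt M A = r_t (invmx M) A.
Proof.
move=> hM; rewrite /r_tdt /r_t mxrank_unit // -corank_invmx_add_indic //.
(* As [M] has full rank, the minuend is [n], which is split into the rank and corank of
   [invmx M + I_A]. *)
by rewrite -[X in (X - _)%N](rank_corank _ _ (invmx M + indic_mx F A)) addnK.
Qed.

Lemma r_dt_invmx (F : fieldType) (n : nat) (M : 'M[F]_n) (A : {set 'I_n}) :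
  M \in unitmx -> r_dt M A = r_td (invmx M) A.
Proof.
move=> hM; rewrite /r_dt /r_td corank_princ_invmx //.
have rkN := rank_corank _ _ (invmx M + indic_mx F A).
have rkA := rank_corank _ _ (princ_submx A (M + indic_mx F A)).
have rkC := rank_corank _ _ (princ_submx (~: A) M).
have cardA : (#|A| + #|~: A| = n)%N by rewrite cardsC card_ord.
(* Adding the coranks of [M[A^c]] and of [invmx M + I_A] turns both sides into [n]. The first
   addition cancels the subtraction in [r_td], which is legitimate because it is not truncated. *)
apply/eqP; rewrite -(eqn_add2r (corank (princ_submx (~: A) M))) subnK.
  rewrite -(eqn_add2r (corank (invmx M + indic_mx F A))) rkN.
  rewrite corank_invmx_add_indic // -addnA [X in (_ + X)%N]addnC addnACA.
  by rewrite rkA rkC cardA.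
by rewrite -corank_princ_invmx // r_td_untruncated.
Qed.

Theorem theorem5p6 (F : fieldType) (n : nat) (M : 'M[F]_n)
  (hM : M \in unitmx) :
  P_tdt M = P_t (invmx M) /\ P_dt M = P_td (invmx M).
Proof.
by split; apply: eq_bigr => A _; rewrite ?r_tdt_invmx ?r_dt_invmx.
Qed.
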